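(* Let $(A,\nwarrow,\nearrow,\alpha)$ be a $3$-Hom-L-dendriform algebra and let $E:A\to A$ be an almost product structure on $A$ (a linear map with $E^2=\mathrm{id}_A$) commuting with $\alpha$. 1. If for all $x,y,z\in A$, $E\nwarrow(x,y,z)=\nwarrow(Ex,y,z)=\nwarrow(x,y,Ez)$ and $E\nearrow(x,y,z)=\nearrow(Ex,y,z)=\nearrow(x,Ey,z)=\nearrow(x,y,Ez)$, then $E$ is a product structure on $A$ (called a strict product structure). 2. If for all $x,y,z\in A$ and $\ast\in\{\nwarrow,\nearrow\}$, $\ast(x,y,z)=-\ast(x,Ey,Ez)-\ast(Ex,y,Ez)-\ast(Ex,Ey,z)$, then $E$ is a product structure on $A$ (called an abelian product structure). 3. If for all $x,y,z\in A$ and $\ast\in\{\nwarrow,\nearrow\}$, $\ast(x,y,z)=E\big(\ast(x,y,Ez)+\ast(Ex,y,z)+\ast(x,Ey,z)\big)$, then $E$ is a product structure on $A$ (called a strong product structure). 4. If for all $x,y,z\in A$, $E\nwarrow(x,y,z)=\nwarrow(Ex,Ey,Ez)$ and $E\nearrow(x,y,z)=\nearrow(Ex,Ey,Ez)$, then $E$ is a product structure on $A$ (called a perfect product structure).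
   Context: Vector spaces are finite-dimensional over $\mathbb R$ or $\mathbb C$. A $3$-Hom-L-dendriform algebra is a tuple $(A,\nwarrow,\nearrow,\alpha)$ where $A$ is a vector space, $\nwarrow,\nearrow:\otimes^3A\to A$ and $\alpha:A\to A$ are linear, $\alpha$ is multiplicative (i.e. $\alpha(\nwarrow(x,y,z))=\nwarrow(\alpha(x),\alpha(y),\alpha(z))$ and likewise for $\nearrow$), and, writing $\{x,y,z\}^h=\nwarrow(x,y,z)+\nearrow(x,y,z)-\nearrow(y,x,z)$, $\{x,y,z\}^v=\nwarrow(x,y,z)+\nearrow(z,x,y)-\nearrow(z,y,x)$, $[x,y,z]^C=\{x,y,z\}^h+\{y,z,x\}^h+\{z,x,y\}^h$ (equal to the same cyclic sum of $\{\cdot,\cdot,\cdot\}^v$), the following hold for all $x_1,\dots,x_5\in A$ (where $\circlearrowleft_{1,2,3}$ is the sum over cyclic permutations of the indices $1,2,3$): (0) $\nwarrow(x_1,x_2,x_3)+\nwarrow(x_2,x_1,x_3)=0$; (1) $\nwarrow(\alpha(x_1),\alpha(x_2),\nwarrow(x_3,x_4,x_5))-\nwarrow(\alpha(x_3),\alpha(x_4),\nwarrow(x_1,x_2,x_5))=\nwarrow([x_1,x_2,x_3]^C,\alpha(x_4),\alpha(x_5))-\nwarrow([x_1,x_2,x_4]^C,\alpha(x_3),\alpha(x_5))$; (2) $\nwarrow(\alpha(x_1),\alpha(x_2),\nearrow(x_5,x_3,x_4))-\nearrow(\alpha(x_5),\alpha(x_3),\{x_1,x_2,x_4\}^h)=\nearrow(\alpha(x_5),[x_1,x_2,x_3]^C,\alpha(x_4))+\nearrow(\{x_1,x_2,x_5\}^v,\alpha(x_3),\alpha(x_4))$;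 (3) $\nearrow(\alpha(x_5),\alpha(x_1),\{x_2,x_3,x_4\}^h)-\nwarrow(\alpha(x_2),\alpha(x_3),\nearrow(x_5,x_1,x_4))=\nearrow(\{x_1,x_2,x_5\}^v,\alpha(x_3),\alpha(x_4))-\nearrow(\{x_1,x_3,x_5\}^v,\alpha(x_2),\alpha(x_4))$; (4) $\nwarrow([x_1,x_2,x_3]^C,\alpha(x_4),\alpha(x_5))=\circlearrowleft_{1,2,3}\nwarrow(\alpha(x_1),\alpha(x_2),\nwarrow(x_3,x_4,x_5))$; (5) $\nearrow(\alpha(x_5),[x_1,x_2,x_3]^C,\alpha(x_4))=\circlearrowleft_{1,2,3}\nwarrow(\alpha(x_1),\alpha(x_2),\nearrow(x_5,x_3,x_4))$; (6) $\nwarrow(\alpha(x_1),\alpha(x_2),\nearrow(x_5,x_3,x_4))+\nearrow(\alpha(x_5),\alpha(x_1),\{x_2,x_3,x_4\}^h)=\nearrow(\alpha(x_5),\alpha(x_2),\{x_1,x_3,x_4\}^h)+\nearrow(\{x_1,x_2,x_5\}^v,\alpha(x_3),\alpha(x_4))$. A product structure on $A$ is a linear map $E:A\to A$ with $E^2=\mathrm{id}_A$ which is a Nijenhuis operator; equivalently $E^2=\mathrm{id}_A$, $E\alpha=\alpha E$ and, for $\ast\in\{\nwarrow,\nearrow\}$ and all $x,y,z\in A$, $$E\ast(x,y,z)=\ast(Ex,Ey,Ez)+\ast(Ex,y,z)+\ast(x,Ey,z)+\ast(x,y,Ez)-E\ast(Ex,Ey,z)-E\ast(x,Ey,Ez)-E\ast(Ex,y,Ez).$$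 *)

(* Defs.v *)
From HB Require Import structures.
From mathcomp Require Import all_boot all_order all_algebra.
From mathcomp Require Import reals complex.

Set Implicit Arguments.
Unset Strict Implicit.
Unset Printing Implicit Defensive.

Import GRing.Theory.
Local Open Scope ring_scope.

(* Any [realType] is a model of the real numbers. *)
Inductive real_or_complex (R : realType) : fieldType -> Prop :=
  | IsReal : real_or_complex R R
  | IsComplex : real_or_complex R (complex R).

(* A linear map from the third tensor power of A to A, in curried form. *)
Definition trilinear (K : fieldType) (A : vectType K) (f : A -> A -> A -> A) :=
  [/\ forall y z, linear (fun x => f x y z),
      forall x z, linear (fun y => f x y z)
    & forall x y, linear (fun z => f x y z)].

Definition multiplicative (K : fieldType) (A : vectType K)
    (f : A -> A -> A -> A) (alpha : 'End(A)) :=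
  forall x y z, alpha (f x y z) = f (alpha x) (alpha y) (alpha z).

Section Brackets.
Variables (K : fieldType) (A : vectType K) (nw ne : A -> A -> A -> A).

Definition hbracket (x y z : A) : A := nw x y z + ne x y z - ne y x z.

Definition vbracket (x y z : A) : A := nw x y z + ne z x y - ne z y x.

Definition Cbracket (x y z : A) : A :=
  hbracket x y z + hbracket y z x + hbracket z x y.

Lemma Cbracket_vE (x y z : A) :
  Cbracket x y z = vbracket x y z + vbracket y z x + vbracket z x y.
Proof.
rewrite /Cbracket /hbracket /vbracket !addrA.
by rewrite [LHS](ACl (1*8*6*4*2*9*7*5*3)).
Qed.

End Brackets.

(* [nw] and [ne] are the operations written with a north-west and a
   north-east arrow. *)
Record homLDendriform3 (K : fieldType) (A : vectType K) := HomLDendriform3 {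
  nw : A -> A -> A -> A;
  ne : A -> A -> A -> A;
  twist : 'End(A);
  nw_trilinear : trilinear nw;
  ne_trilinear : trilinear ne;
  nw_multiplicative : multiplicative nw twist;
  ne_multiplicative : multiplicative ne twist;
  ld_skew : forall x1 x2 x3, nw x1 x2 x3 + nw x2 x1 x3 = 0;
  ld_axiom1 : forall x1 x2 x3 x4 x5,
    nw (twist x1) (twist x2) (nw x3 x4 x5)
      - nw (twist x3) (twist x4) (nw x1 x2 x5)
    = nw (Cbracket nw ne x1 x2 x3) (twist x4) (twist x5)
      - nw (Cbracket nw ne x1 x2 x4) (twist x3) (twist x5);
  ld_axiom2 : forall x1 x2 x3 x4 x5,
    nw (twist x1) (twist x2) (ne x5 x3 x4)
      - ne (twist x5) (twist x3) (hbracket nw ne x1 x2 x4)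
    = ne (twist x5) (Cbracket nw ne x1 x2 x3) (twist x4)
      + ne (vbracket nw ne x1 x2 x5) (twist x3) (twist x4);
  ld_axiom3 : forall x1 x2 x3 x4 x5,
    ne (twist x5) (twist x1) (hbracket nw ne x2 x3 x4)
      - nw (twist x2) (twist x3) (ne x5 x1 x4)
    = ne (vbracket nw ne x1 x2 x5) (twist x3) (twist x4)
      - ne (vbracket nw ne x1 x3 x5) (twist x2) (twist x4);
  ld_axiom4 : forall x1 x2 x3 x4 x5,
    nw (Cbracket nw ne x1 x2 x3) (twist x4) (twist x5)
    = nw (twist x1) (twist x2) (nw x3 x4 x5)
      + nw (twist x2) (twist x3) (nw x1 x4 x5)
      + nw (twist x3) (twist x1) (nw x2 x4 x5);
  ld_axiom5 : forall x1 x2 x3 x4 x5,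
    ne (twist x5) (Cbracket nw ne x1 x2 x3) (twist x4)
    = nw (twist x1) (twist x2) (ne x5 x3 x4)
      + nw (twist x2) (twist x3) (ne x5 x1 x4)
      + nw (twist x3) (twist x1) (ne x5 x2 x4);
  ld_axiom6 : forall x1 x2 x3 x4 x5,
    nw (twist x1) (twist x2) (ne x5 x3 x4)
      + ne (twist x5) (twist x1) (hbracket nw ne x2 x3 x4)
    = ne (twist x5) (twist x2) (hbracket nw ne x1 x3 x4)
      + ne (vbracket nw ne x1 x2 x5) (twist x3) (twist x4)
}.

Section ProductStructures.
Variables (K : fieldType) (A : vectType K) (L : homLDendriform3 A).

Definition almost_product_structure (E : 'End(A)) := (E \o E = \1)%VF.

Definition commutes_with_twist (E : 'End(A)) :=
  (E \o twist L = twist L \o E)%VF.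

(* The Nijenhuis identity for one ternary operation, for an arbitrary
   linear map N. *)
Definition nijenhuis_for (f : A -> A -> A -> A) (N : 'End(A)) :=
  forall x y z,
    f (N x) (N y) (N z)
    = N (f (N x) (N y) z + f x (N y) (N z) + f (N x) y (N z))
      - N (N (f (N x) y z + f x (N y) z + f x y (N z)))
      + N (N (N (f x y z))).

Definition nijenhuis_operator (N : 'End(A)) :=
  [/\ commutes_with_twist N,
      nijenhuis_for (nw L) N
    & nijenhuis_for (ne L) N].

Definition product_structure (E : 'End(A)) :=
  almost_product_structure E /\ nijenhuis_operator E.

Definition product_identity (f : A -> A -> A -> A) (E : 'End(A)) :=
  forall x y z,
    E (f x y z)
    = f (E x) (E y) (E z)
      + f (E x) y z + f x (E y) z + f x y (E z)
      - E (f (E x) (E y) z) - E (f x (E y) (E z)) - E (f (E x) y (E z)).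

Lemma almost_productK (E : 'End(A)) :
  almost_product_structure E -> involutive E.
Proof. by move=> EE x; rewrite -comp_lfunE EE id_lfunE. Qed.

Lemma nijenhuis_forE (f : A -> A -> A -> A) (E : 'End(A)) :
  almost_product_structure E -> nijenhuis_for f E <-> product_identity f E.
Proof.
move=> /almost_productK EK.
have aux (V : zmodType) (n a1 a2 a3 b1 b2 b3 e : V) :
    n = a1 + a2 + a3 - (b1 + b2 + b3) + e <->
    e = n + b1 + b2 + b3 - a1 - a2 - a3.
  have -> : n + b1 + b2 + b3 - a1 - a2 - a3
            = n + (b1 + b2 + b3) - (a1 + a2 + a3) by rewrite !opprD !addrA.
  move: (a1 + a2 + a3) (b1 + b2 + b3) => a b; split=> ->.
    by rewrite (addrAC (a - b)) subrK addrAC subrr add0r.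
  by rewrite addrC addrA subrK addrK.
split=> H x y z; have := H x y z; rewrite !EK !(linearD E).
  by move/aux.
by move=> ?; apply/aux.
Qed.

Lemma product_structureE (E : 'End(A)) :
  product_structure E <->
  [/\ almost_product_structure E, commutes_with_twist E,
      product_identity (nw L) E & product_identity (ne L) E].
Proof.
split=> [[EE [EC nwE neE]] | [EE EC nwE neE]].
  by split=> //; apply/nijenhuis_forE.
by split=> //; split=> //; apply/nijenhuis_forE.
Qed.

End ProductStructures.

(* Main.v *)
Require Import Defs.
From HB Require Import structures.
From mathcomp Require Import all_boot all_order all_algebra.
From mathcomp Require Import reals complex.
Import GRing.Theory.
Local Open Scope ring_scope.

(** For an involution commuting with the twist, being Nijenhuis amounts to [product_identity] for
    each operation separately ([product_structureE]). Each of the four conditions then makes the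
    terms of that identity cancel. The abelian and strong conditions are used twice: at (x, y, z) to
    expand the left side, and at (E x, E y, E z) to expand the first term on the right. *)

Section TernaryOperation.
Variables (K : fieldType) (A : vectType K) (f : A -> A -> A -> A) (E : 'End(A)).
Hypothesis EK : involutive E.

(** Pulling every [E] out and using that its square is the identity, all seven terms on the right
    become [E (f x y z)] up to sign: four positive, three negative. *)
Lemma strict_product_identity :
  (forall x y z, E (f x y z) = f (E x) y z) ->
  (forall x y z, E (f x y z) = f x (E y) z) ->
  (forall x y z, E (f x y z) = f x y (E z)) ->
  product_identity f E.
Proof.
by move=> Ex Ey Ez x y z; rewrite -!Ex -!Ey -!Ez !EK !addrK.
Qed.

(* The hypothesis at (E x, E y, E z) makes the first four terms of the
   product identity cancel. *)
Lemma abelian_product_identity :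
  (forall x y z,
     f x y z = - f x (E y) (E z) - f (E x) y (E z) - f (E x) (E y) z) ->
  product_identity f E.
Proof.
move=> fE x y z; rewrite [in LHS]fE (fE (E x) (E y) (E z)) !EK.
rewrite !linearB !linearN /= [RHS](ACl ((4*5*6)*(1*2*3)*(8*9*7))) /=.
by rewrite -!opprD subrr add0r.
Qed.

(* The hypothesis at (E x, E y, E z) cancels the first term of the product
   identity against the last three. *)
Lemma strong_product_identity :
  (forall x y z, f x y z = E (f x y (E z) + f (E x) y z + f x (E y) z)) ->
  product_identity f E.
Proof.
move=> fE x y z; rewrite [in LHS]fE (fE (E x) (E y) (E z)) !EK.
rewrite !linearD /= [RHS](ACl ((6*4*5)*((1*2*3)*(7*8*9)))) /=.
by rewrite -!opprD subrr addr0.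
Qed.

(** Since [E] is an involution, moving it inside f toggles it on each argument, so the three
    subtracted terms are exactly those with a single [E]. *)
Lemma perfect_product_identity :
  (forall x y z, E (f x y z) = f (E x) (E y) (E z)) ->
  product_identity f E.
Proof.
move=> fE x y z; rewrite !fE !EK.
by rewrite addrK (addrAC _ _ (- f (E x) y z)) !addrK.
Qed.

End TernaryOperation.

Theorem proposition4p8 (R : realType) (K : fieldType)
    (hK : real_or_complex R K) (A : vectType K) (L : homLDendriform3 A)
    (E : 'End(A)) (hE : almost_product_structure E)
    (hEalpha : commutes_with_twist L E) :
  [/\ (forall x y z : A,
         [/\ E (nw L x y z) = nw L (E x) y z,
             nw L (E x) y z = nw L x y (E z),
             E (ne L x y z) = ne L (E x) y z,
             ne L (E x) y z = ne L x (E y) z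
           & ne L x (E y) z = ne L x y (E z)]) ->
      product_structure L E,
      (forall x y z : A,
         nw L x y z = - nw L x (E y) (E z) - nw L (E x) y (E z)
                      - nw L (E x) (E y) z /\
         ne L x y z = - ne L x (E y) (E z) - ne L (E x) y (E z)
                      - ne L (E x) (E y) z) ->
      product_structure L E,
      (forall x y z : A,
         nw L x y z = E (nw L x y (E z) + nw L (E x) y z + nw L x (E y) z) /\
         ne L x y z = E (ne L x y (E z) + ne L (E x) y z + ne L x (E y) z)) ->
      product_structure L E
    & (forall x y z : A,
         E (nw L x y z) = nw L (E x) (E y) (E z) /\
         E (ne L x y z) = ne L (E x) (E y) (E z)) ->
      product_structure L E].
Proof.
have EK := almost_productK hE.
(* Each of the four conditions leaves two goals, the identity for [nw] and the one for [ne]. *)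
split=> H; apply/product_structureE; split=> //.
- have nwz x y z : E (nw L x y z) = nw L x y (E z) by case: (H x y z) => ->.
  have nwx x y z : E (nw L x y z) = nw L (E x) y z by case: (H x y z).
  apply: strict_product_identity => // x y z.
  (* No hypothesis on the middle argument of nw: skew-symmetry supplies it. *)
  have nwC u v w : nw L u v w = - nw L v u w.
    by apply/eqP; rewrite -addr_eq0 ld_skew.
  by rewrite nwC linearN /= nwx -nwC.
- have nex x y z : E (ne L x y z) = ne L (E x) y z by case: (H x y z).
  apply: strict_product_identity => // x y z; rewrite nex.
    by case: (H x y z).
  by case: (H x y z) => _ _ _ ->.
- by apply: abelian_product_identity => // x y z; case: (H x y z).
- by apply: abelian_product_identity => // x y z; case: (H x y z).
- by apply: strong_product_identity => // x y z; case: (H x y z).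
- by apply: strong_product_identity => // x y z; case: (H x y z).
- by apply: perfect_product_identity => // x y z; case: (H x y z).
- by apply: perfect_product_identity => // x y z; case: (H x y z).
Qed.
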